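(* For integers $q,n\ge1$ let \[ a(q)=\begin{cases}1 & q \text{ odd}\\ 2 & q\text{ even}\end{cases}\qquad\text{and}\qquad b(q,n)=\begin{cases}\frac12 & q\text{ odd and } n \text{ even}\\ 0&\text{otherwise.}\end{cases}\] Then for the $(q,n)$ torus link $T_{q,n}$ with $1\leq q\leq n$, \[ \frac{(q-1)n}{2}\leq\sigma(T_{q,n})\leq\frac{q(n+1)}{2}-a(q)-b(q,n). \]
   Context: $T_{q,n}$ is the positive $(q,n)$ torus link, with all components oriented in parallel (the closure of the positive $q$-braid $(\sigma_1\cdots\sigma_{q-1})^n$). $\sigma$ denotes the ordinary link signature, with the sign convention that it is non-negative for positive links (e.g. $\sigma(T_{2,3})=2$). *)

(* Defs.v *)
From HB Require Import structures.
From mathcomp Require Import all_boot all_order all_algebra all_field.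

Set Implicit Arguments.
Unset Strict Implicit.
Unset Printing Implicit Defensive.

Import Order.TTheory GRing.Theory Num.Theory.
Local Open Scope ring_scope.

(* Links are presented as closures of braids.  The letter (i, true) of a word
   on q strands is sigma_(i+1), the crossing that is positive (right-handed)
   in the closure, all strands being oriented in parallel; (i, false) is its
   inverse.  There are q - 1 generators, indexed from 0. *)
Definition braid_word (q : nat) : Type := seq ('I_q.-1 * bool).

Definition torus_braid (q n : nat) : braid_word q :=
  flatten (nseq n [seq (i, true) | i <- enum 'I_q.-1]).

(* Seifert's algorithm, applied to the closure of w, gives a surface F made of
   q horizontal disks D_0, ..., D_(q-1), stacked in this order upwards and
   oriented upwards (so that their boundaries run anticlockwise seen from
   above), and one half-twisted band for each letter of w; the band of
   (i, e) joins D_i to D_(i+1), is twisted according to e, and the bands occur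
   along the boundaries in the order of the letters of w. *)
Definition generator (q : nat) (w : braid_word q) (k : 'I_(size w)) : nat :=
  (tnth (in_tuple w) k).1.

Definition crossing_sign (q : nat) (w : braid_word q) (k : 'I_(size w)) : int :=
  if (tnth (in_tuple w) k).2 then 1 else -1.

(* The pair (k, l) of successive occurrences of one generator stands for the
   simple closed curve that goes up through band k, across the upper disk, down
   through band l and back across the lower disk.  These curves form a basis of
   H_1(F; Z). *)
Definition loops (q : nat) (w : braid_word q) : {set 'I_(size w) * 'I_(size w)} :=
  [set c : 'I_(size w) * 'I_(size w) | [&& (c.1 < c.2)%N, generator c.1 == generator c.2 &
     [forall m : 'I_(size w),
        (c.1 < m < c.2)%N ==> (generator m != generator c.1)]]].

(* The linking number lk(c, d^+), d^+ being d pushed off F on its positive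
   (upper) side:
   - c = d: each of the two bands contributes minus half its sign;
   - c and d run through a common band in opposite directions: its sign e
     satisfies lk(c, d^+) + lk(d, c^+) = e, and if d precedes c then
     lk(c, d^+) - lk(d, c^+) = 1, because c and d meet once in F;
   - c lies just above d: their linking number is minus the intersection number
     of c and d in the disk they share, which is nonzero only if their bands
     alternate around this disk;
   - c lies just below d: pushing d up separates it from c. *)
Definition seifert_pairing (q : nat) (w : braid_word q)
    (c d : 'I_(size w) * 'I_(size w)) : int :=
  if c == d then - ((crossing_sign c.1 + crossing_sign c.2) %/ 2)%Z
  else if d.2 == c.1 then (if crossing_sign c.1 == 1 then 1 else 0)
  else if c.2 == d.1 then (if crossing_sign c.2 == 1 then 0 else -1)
  else if generator c.1 == (generator d.1).+1 then
    if [&& c.1 < d.1, d.1 < c.2 & c.2 < d.2]%N then 1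
    else if [&& d.1 < c.1, c.1 < d.2 & d.2 < c.2]%N then -1
    else 0
  else 0.

Definition seifert_matrix (q : nat) (w : braid_word q) : 'M[int]_#|loops w| :=
  \matrix_(i, j) seifert_pairing (enum_val i) (enum_val j).

Definition eigenvalues (n : nat) (A : 'M[algC]_n) : seq algC :=
  sval (closed_field_poly_normal (char_poly A)).

(* For symmetric A, whose eigenvalues are real. *)
Definition matrix_signature (n : nat) (A : 'M[int]_n) : int :=
  let s := eigenvalues (map_mx intr A) in
  (count (fun x => 0 < x) s)%:Z - (count (fun x => x < 0) s)%:Z.

(* The symmetrized Seifert form of a positive Hopf band is (-2); the minus sign
   makes the signature of positive links nonnegative. *)
Definition link_signature (q : nat) (w : braid_word q) : int :=
  - matrix_signature (seifert_matrix w + (seifert_matrix w)^T).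

Definition torus_link_signature (q n : nat) : int :=
  link_signature (torus_braid q n).

Definition coeff_a (q : nat) : rat := if odd q then 1 else 2.

Definition coeff_b (q n : nat) : rat := if odd q && ~~ odd n then 1 / 2 else 0.

(* Main.v *)
Require Import Defs.
From mathcomp Require Import all_boot all_order all_algebra all_field.
From mathcomp Require Import zify ring lra.

(** The loops of the Seifert surface of T(q,n) form a (q-1) x (n-1) grid.  For
    y <> 1 with y^q = 1 and z <> 1 with z^n = 1, the vectors with coordinates
    (y^(i+1) - 1) z^(i+1) (z^(t+1) - 1) are orthogonal for the Seifert form,
    with squares - q n (1 - 1/y) (1 - 1/z).  Writing y = exp(2 i pi k/q) and
    z = exp(2 i pi j/n), the sign of the real part of such a square only depends
    on the position of k/q + j/n with respect to 1/2 and 3/2, and Sylvester's law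
    of inertia gives Brieskorn's formula for the signature.

    Summing over j first gives sigma(q,n+2q) = sigma(q,n) + q^2 - [q odd] and
    sigma(q,n) + sigma(q,2q-n) = q^2 - [q odd] - 2 [q even].  The two bounds are
    then proved together by induction on q + n, since the reflection exchanges
    lower and upper bounds. *)

Set Implicit Arguments.
Unset Strict Implicit.
Unset Printing Implicit Defensive.

Import Order.TTheory GRing.Theory Num.Theory.
Local Open Scope ring_scope.
Local Open Scope sesquilinear_scope.

(** * Brieskorn's count *)

(** With denominators cleared: 1 if k/q + j/n lies strictly between 1/2 and 3/2, -1 if strictly
    outside, 0 on a threshold. *)
Definition lattice_sign (q n k j : nat) : int :=
  (q * n < 2 * (n * k + q * j) < 3 * (q * n))%N%:Z
  - ((2 * (n * k + q * j) < q * n) || (3 * (q * n) < 2 * (n * k + q * j)))%N%:Z.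

Definition lattice_sum (q n : nat) : int :=
  \sum_(1 <= k < q) \sum_(1 <= j < n) lattice_sign q n k j.

Lemma lattice_sumC q n : lattice_sum q n = lattice_sum n q.
Proof.
rewrite /lattice_sum exchange_big_nat /=; apply: eq_bigr => j _.
by apply: eq_bigr => k _; rewrite /lattice_sign (mulnC n q) (addnC (n * k)%N).
Qed.

Lemma sum_nat_gt m n : (m < n)%N ->
  \sum_(1 <= j < n) (m < j)%N%:Z = n%:Z - 1 - m%:Z.
Proof.
move=> mn; rewrite (@big_cat_nat _ _ _ m.+1) //=.
rewrite big_nat big1 ?add0r; last by move=> j /andP[_]; lia.
rewrite big_nat (eq_bigr (fun=> 1)); last by move=> j /andP[mj _]; rewrite mj.
rewrite -big_nat sumr_const_nat; lia.
Qed.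

Lemma sum_nat_le m n : (m < n)%N ->
  \sum_(1 <= j < n) (j <= m)%N%:Z = m%:Z.
Proof.
move=> mn; rewrite (@big_cat_nat _ _ _ m.+1) //=.
rewrite [X in _ + X]big_nat [X in _ + X]big1 ?addr0; last by move=> j /andP[]; lia.
rewrite big_nat (eq_bigr (fun=> 1)); last by move=> j /andP[_]; rewrite ltnS => ->.
rewrite -big_nat sumr_const_nat; lia.
Qed.

Lemma sum_sign_multiples d X n : (0 < d)%N -> (X %/ d < n)%N ->
  \sum_(1 <= j < n) ((X < d * j)%N%:Z - (d * j < X)%N%:Z)
  = n%:Z - 1 - (X %/ d)%:Z - (X.-1 %/ d)%:Z.
Proof.
move=> d0 Xn; rewrite sumrB -(sum_nat_gt Xn); congr (_ - _).
  by apply: eq_bigr => j _; rewrite mulnC -ltn_divLR.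
rewrite -(@sum_nat_le (X.-1 %/ d) n); last first.
  by apply: leq_ltn_trans Xn; apply: leq_div2r; apply: leq_pred.
apply: eq_big_nat => j /andP[j0 _].
rewrite leq_divRL // mulnC.
by case: X {Xn} => [|X]; nia.
Qed.

(** This is |q - 2k|: one of the truncated differences is always 0. *)
Definition gap (q k : nat) : nat := (q - 2 * k + (2 * k - q))%N.

(* Up to [j -> n - j], which handles [q < 2 * k], only the threshold [q * n]
   matters: [2 * q * j] is compared with [n * gap q k].  When [gap q k = 0] the
   truncated predecessor makes the last quotient 0, which is the right value. *)
Definition row_sum (q n k : nat) : int :=
  n%:Z - 1 - ((n * gap q k) %/ (2 * q))%:Z - ((n * gap q k).-1 %/ (2 * q))%:Z.

Lemma row_sumE q n k : (0 < k < q)%N -> (0 < n)%N ->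
  \sum_(1 <= j < n) lattice_sign q n k j = row_sum q n k.
Proof.
move=> /andP[k0 kq] n0.
have Xn : ((n * gap q k) %/ (2 * q) < n)%N.
  rewrite ltn_divLR; last lia.
  rewrite ltn_pmul2l // /gap; lia.
rewrite /row_sum -sum_sign_multiples //; last lia.
(* If k/q <= 1/2 then k/q + j/n < 3/2, and only the threshold 1/2 can be crossed; otherwise only 3/2
   can. *)
case: (leqP (2 * k) q) => kq2.
  apply: eq_big_nat => j /andP[j0 jn]; rewrite /lattice_sign /gap.
  have -> : (2 * k - q = 0)%N by lia.
  rewrite addn0 (mulnBr n q (2 * k)%N).
  congr (_ - _); congr (Posz (nat_of_bool _)); nia.
rewrite big_nat_rev; apply: eq_big_nat => j /andP[j0 jn]; rewrite /lattice_sign /gap.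
have -> : (q - 2 * k = 0)%N by lia.
rewrite add0n (mulnBr n (2 * k)%N q).
have -> : (1 + n - j.+1 = n - j)%N by lia.
rewrite (mulnBr q n j).
have : (q * j <= q * n)%N by nia.
have : (n * q <= n * (2 * k))%N by nia.
have : (n * k <= n * q)%N by nia.
have : (q <= q * j)%N by nia.
have : (0 < q * n)%N by nia.
move=> *.
have: (n * (2 * k) = 2 * (n * k))%N by lia.
have: (q * n = n * q)%N by lia.
move=> *; congr (_ - _); congr (Posz (nat_of_bool _)); nia.
Qed.

(** Both quotients grow by [gap q k]. A zero gap is apart because the truncated predecessor does not
    follow the shift. *)
Lemma row_sum_add2q q n k : (0 < k < q)%N -> (0 < n)%N ->
  row_sum q (n + 2 * q) k = row_sum q n k + (2 * q)%:Z - (2 * gap q k)%:Z.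
Proof.
move=> /andP[k0 kq] n0; rewrite /row_sum.
set D := gap q k.
have -> : ((n + 2 * q) * D = D * (2 * q) + n * D)%N by lia.
rewrite divnMDl; last lia.
have [D0 | D0] := posnP D.
  by rewrite D0 muln0 /= div0n; lia.
have -> : ((D * (2 * q) + n * D).-1 = D * (2 * q) + (n * D).-1)%N by nia.
rewrite divnMDl; lia.
Qed.

(** The numerators for [n] and [2 * q - n] add up to [gap q k * (2 * q)], so the quotient of one and
    that of the predecessor of the other add up to [gap q k - 1]. For a zero gap all quotients are
    0, hence the correction. *)
Lemma row_sum_reflect q n k : (0 < k < q)%N -> (0 < n < 2 * q)%N ->
  row_sum q n k + row_sum q (2 * q - n) k
  = (2 * q)%:Z - (2 * gap q k)%:Z - 2 * (gap q k == 0%N)%:Z.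
Proof.
move=> /andP[k0 kq] /andP[n0 nq]; rewrite /row_sum.
set D := gap q k.
have [D0 | D0] := posnP D.
  by rewrite D0 !muln0 /= div0n; lia.
have aux a b : (0 < a)%N -> (0 < b)%N -> (a + b = D * (2 * q))%N ->
    (a %/ (2 * q) + b.-1 %/ (2 * q) = D.-1)%N.
  move=> a0 b0 ab.
  have := divn_eq a (2 * q); have := @ltn_pmod a (2 * q).
  move: (a %/ _)%N (a %% _)%N => u r; move=> /(_ _)/[dup] + _.
  have -> : (0 < 2 * q)%N by lia.
  move=> /(_ isT) rq au.
  have uD : (u < D)%N.
    by rewrite -(@ltn_pmul2r (2 * q)); lia.
  have -> : (b.-1 = (D - u.+1) * (2 * q) + (2 * q - r.+1))%N.
    have : (u.+1 * (2 * q) <= D * (2 * q))%N by rewrite leq_mul2r uD orbT.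
    rewrite mulnBl; lia.
  rewrite divnMDl ?divn_small; lia.
have e : (n * D + (2 * q - n) * D = D * (2 * q))%N by nia.
have nD0 : (0 < n * D)%N by rewrite muln_gt0 n0.
have mD0 : (0 < (2 * q - n) * D)%N by rewrite muln_gt0 subn_gt0 nq.
have h1 := aux _ _ nD0 mD0 e.
have h2 := aux _ _ mD0 nD0 (etrans (addnC _ _) e).
move: h1 h2.
move: (n * D %/ _)%N ((n * D).-1 %/ _)%N.
move: ((2 * q - n) * D %/ _)%N (((2 * q - n) * D).-1 %/ _)%N.
clear -D0 nq; lia.
Qed.

(** Shift and reflection both miss [n = 2 * q], whose partner would be [n = 0]. *)
Lemma row_sum_2q q k : (0 < k < q)%N ->
  row_sum q (2 * q) k = (2 * q)%:Z - (2 * gap q k)%:Z - (gap q k == 0%N)%:Z.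
Proof.
move=> /andP[k0 kq]; rewrite /row_sum.
set D := gap q k.
rewrite mulKn; last lia.
have [D0 | D0] := posnP D.
  by rewrite D0 !muln0 /= div0n; lia.
have -> : ((2 * q * D).-1 = D.-1 * (2 * q) + (2 * q).-1)%N by nia.
rewrite divnMDl ?divn_small; lia.
Qed.

(** Splitting off both ends allows induction in steps of two, since [gap q.+2 k.+1 = gap q k]. *)
Lemma sum_nat_shift2 (F : nat -> int) q : (0 < q)%N ->
  \sum_(1 <= k < q.+2) F k = F 1 + (\sum_(1 <= k < q) F k.+1) + F q.+1.
Proof.
move=> q0; rewrite big_nat_recr //=; congr (_ + _).
by rewrite big_add1 /= big_ltn.
Qed.

Lemma sum_gap q : (0 < q)%N ->
  \sum_(1 <= k < q) (2 * gap q k)%:Z = q%:Z ^+ 2 - 2 * q%:Z + (odd q)%:Z.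
Proof.
elim/ltn_ind: q => -[//|[|[|q]]] IH _; [by rewrite big_geq | by rewrite big_nat1|].
rewrite sum_nat_shift2 //.
have -> : \sum_(1 <= k < q.+1) (2 * gap q.+3 k.+1)%:Z
        = \sum_(1 <= k < q.+1) (2 * gap q.+1 k)%:Z.
  by apply: eq_bigr => k _; rewrite /gap; lia.
rewrite IH // !expr2 /gap !oddS !negbK; clear IH; nia.
Qed.

Lemma sum_gap_eq0 q : (0 < q)%N ->
  \sum_(1 <= k < q) (gap q k == 0%N)%:Z = (~~ odd q)%:Z.
Proof.
elim/ltn_ind: q => -[//|[|[|q]]] IH _; [by rewrite big_geq | by rewrite big_nat1|].
rewrite sum_nat_shift2 //.
have -> : \sum_(1 <= k < q.+1) (gap q.+3 k.+1 == 0%N)%:Z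
        = \sum_(1 <= k < q.+1) (gap q.+1 k == 0%N)%:Z.
  by apply: eq_bigr => k _; congr (Posz (nat_of_bool _)); rewrite /gap; lia.
rewrite IH // /gap !oddS !negbK; clear IH; lia.
Qed.

Lemma sum_2q_gap q : (0 < q)%N ->
  \sum_(1 <= k < q) ((2 * q)%:Z - (2 * gap q k)%:Z) = q%:Z ^+ 2 - (odd q)%:Z.
Proof.
move=> q0; rewrite sumrB sum_gap // sumr_const_nat.
rewrite -mulr_natr; nia.
Qed.

(** * Symmetries of the whole count, and its bounds *)

Lemma lattice_sumE q n : (0 < n)%N ->
  lattice_sum q n = \sum_(1 <= k < q) row_sum q n k.
Proof. by move=> n0; apply: eq_big_nat => k kq; apply: row_sumE. Qed.

Lemma lattice_sum_add2q q n : (0 < q)%N -> (0 < n)%N ->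
  lattice_sum q (n + 2 * q) = lattice_sum q n + q%:Z ^+ 2 - (odd q)%:Z.
Proof.
move=> q0 n0; rewrite !lattice_sumE ?addn_gt0 ?n0 // -addrA -sum_2q_gap // -big_split /=.
by apply: eq_big_nat => k kq; rewrite row_sum_add2q // addrA.
Qed.

Lemma lattice_sum_reflect q n : (0 < n < 2 * q)%N ->
  lattice_sum q n + lattice_sum q (2 * q - n)
  = q%:Z ^+ 2 - (odd q)%:Z - 2 * (~~ odd q)%:Z.
Proof.
move=> /andP[n0 nq]; have q0 : (0 < q)%N by lia.
rewrite !lattice_sumE ?subn_gt0 // -sum_2q_gap // -sum_gap_eq0 // mulr_sumr.
rewrite -big_split -sumrB /=; apply: eq_big_nat => k kq.
by rewrite row_sum_reflect ?n0.
Qed.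

Lemma lattice_sum_2q q : (0 < q)%N ->
  lattice_sum q (2 * q) = q%:Z ^+ 2 - (odd q)%:Z - (~~ odd q)%:Z.
Proof.
move=> q0; rewrite lattice_sumE; last lia.
rewrite -sum_2q_gap // -sum_gap_eq0 // -sumrB.
by apply: eq_big_nat => k kq; rewrite row_sum_2q.
Qed.

(* Twice the bounds, so as to stay in the integers. *)
Lemma lattice_sum_bounds q n : (0 < q <= n)%N ->
  (q%:Z - 1) * n%:Z <= 2 * lattice_sum q n
  <= q%:Z * (n%:Z + 1) - 2 - 2 * (~~ odd q)%:Z - (odd q && ~~ odd n)%:Z.
Proof.
have [m] := ubnP (q + n); elim: m => // m IH in q n *.
rewrite ltnS => qnm /andP[q0 qn].
have [nq | nq | ->] := ltngtP n (2 * q); last first.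
- rewrite lattice_sum_2q //; case: (boolP (odd q)) => oq /=; nia.
- have [p p0 en] : exists2 p, (0 < p)%N & n = (p + 2 * q)%N.
    by exists (n - 2 * q)%N; lia.
  have e := lattice_sum_add2q q0 p0; rewrite -en in e.
  (* The shift reduces to [(q, p)], or to [(p, q)] when [p < q]. *)
  have [qp | pq] := leqP q p.
    have := IH q p ltac:(lia); rewrite q0 qp => /(_ isT).
    rewrite e en; case: (boolP (odd q)) => oq; case: (boolP (odd p)) => op;
    rewrite oddD oddM ?(negbTE op) ?op /=; nia.
  have := IH p q ltac:(lia); rewrite p0 ltnW // => /(_ isT).
  rewrite e (lattice_sumC q) en.
  case: (boolP (odd q)) => oq; case: (boolP (odd p)) => op;
    rewrite oddD oddM ?(negbTE op) ?op /=; nia.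
have e := @lattice_sum_reflect q n.
(* The reflection fixes [n = q] and so determines the count there. *)
have [nqe | nqe] := eqVneq n q.
  have := e ltac:(lia); rewrite nqe.
  have -> : (2 * q - q = q)%N by lia.
  case: (boolP (odd q)) => oq /=; nia.
have := e ltac:(lia).
have [p p0 en] : exists2 p, (0 < p)%N & (p + n = 2 * q)%N.
  by exists (2 * q - n)%N; lia.
have -> : (2 * q - n = p)%N by lia.
have := IH p q ltac:(lia) ltac:(lia).
rewrite (lattice_sumC q p).
have op : odd p = odd n.
  by have := congr1 odd en; rewrite oddD oddM /=; case: (odd p) (odd n) => -[].
rewrite op.
move: (lattice_sum p q) (lattice_sum q n) => s t.
have -> : n%:Z = 2 * q%:Z - p%:Z by lia.
clear IH e; rewrite expr2.
(* For [q] odd and [n] even, the last unit of the upper bound comes from parity: [2 * t] is even,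
   [q * (n + 1)] odd. *)
case: (boolP (odd q)) => oq; case: (boolP (odd n)) => on /=; lia.
Qed.

(** * The root of unity of smallest argument *)

Lemma Im_gt0_Re_lt1 (C : numClosedFieldType) (z : C) :
  `|z| = 1 -> 0 < 'Im z -> 'Re z < 1.
Proof.
move=> z1 Iz; rewrite -z1 lt_neqAle (leif_Re_Creal z).1 andbT (leif_Re_Creal z).2.
by apply: contraL Iz => /ger0_real/Creal_ImP ->; rewrite ltxx.
Qed.

(** Turning [z] by the argument of [w] within the closed upper half-plane moves it left; an
    algebraic identity replaces the comparison of arguments. *)
Lemma Re_mul_lt (C : numClosedFieldType) (z w : C) :
  `|z| = 1 -> `|w| = 1 -> 0 < 'Im z -> 0 < 'Im w ->
  0 <= 'Im (z * w) -> 'Re (z * w) < 'Re z.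
Proof.
move=> z1 w1 Iz Iw Izw; rewrite -subr_gt0 -(pmulr_rgt0 _ Iw).
have -> : 'Im w * ('Re z - 'Re (z * w)) = ('Im (z * w) + 'Im z) * (1 - 'Re w).
  have e : 'Im w * 'Im w = 1 - 'Re w * 'Re w.
    by rewrite -[1](expr1n _ 2) -w1 normC2_Re_Im -!expr2 addrAC subrr add0r.
  rewrite ReM ImM.
  transitivity ('Im w * 'Re z * (1 - 'Re w) + 'Im z * ('Im w * 'Im w)); first by ring.
  by rewrite e; ring.
by apply: mulr_gt0; rewrite ?subr_gt0 ?Im_gt0_Re_lt1 // ltr_wpDl.
Qed.

Lemma Im_eq0_unit_norm (C : numClosedFieldType) (z : C) :
  `|z| = 1 -> 'Im z = 0 -> z = 1 \/ z = -1.
Proof.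
move=> z1 /Creal_ImP zR; have := real_normK zR.
by rewrite z1 expr1n => /esym/eqP; rewrite sqrf_eq1 => /orP[] /eqP; [left|right].
Qed.

Lemma unit_norm_expr (C : numClosedFieldType) (z : C) n :
  (0 < n)%N -> z ^+ n = 1 -> `|z| = 1.
Proof. by move=> n0 zn; apply/eqP; rewrite -(pexpr_eq1 n0) // -normrX zn normr1. Qed.

Lemma unit_norm_inv (C : numClosedFieldType) (z : C) : `|z| = 1 -> z^-1 = z^*.
Proof. by move=> z1; rewrite invC_norm z1 expr1n invr1 mul1r. Qed.

(* [M.-root (-1)] has maximal real part among the roots of [-1], so it is not
   the product of two [2M]-th roots of unity of the open upper half-plane: one
   of them would be an [M]-th root of [-1] with a larger real part. *)
Lemma rootCN1_indecomposable (M : nat) (z w : algC) : (1 < M)%N ->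
  z ^+ (2 * M) = 1 -> z * w = M.-root (-1) ->
  0 < 'Im z -> 0 < 'Im w -> False.
Proof.
move=> M1 zM; have M0 := ltnW M1.
(* One of [z], [w] is an [M]-th root of -1, the other of 1. *)
wlog zN1 : z w zM / z ^+ M = -1 => [IH|] zw Iz Iw.
  have /eqP := zM; rewrite mulnC exprM sqrf_eq1 => /orP[] /eqP zM1; last exact: (IH z w).
  have zwM : (w * z) ^+ M = -1 by rewrite mulrC zw rootCK.
  have wM : w ^+ M = -1 by move: zwM; rewrite exprMn zM1 mulr1.
  apply: (IH w z) => //; last by rewrite mulrC.
  by rewrite mulnC exprM wM sqrrN expr1n.
have z1 : `|z| = 1 by apply: unit_norm_expr zM; lia.
have zw1 : `|z * w| = 1.
  apply: (@unit_norm_expr _ _ (M * 2)); first lia.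
  by rewrite zw exprM rootCK // sqrrN expr1n.
have w1 : `|w| = 1 by move: zw1; rewrite normrM z1 mul1r.
have Izw : 0 <= 'Im (z * w) by rewrite zw Im_rootC_ge0.
have := Re_mul_lt z1 w1 Iz Iw Izw.
by rewrite zw => /(le_lt_trans (rootC_Re_max M0 zN1 (ltW Iz))); rewrite ltxx.
Qed.

(** A [2 * M]-th root of unity in the upper half-plane, if not a power of [xi], would stay there
    under repeated division by [xi], whereas [xi ^+ M = -1] takes it to the lower half-plane. So all
    these roots are powers of [xi]. *)
Lemma rootCN1_prim (M : nat) : (1 < M)%N ->
  (2 * M)%N.-primitive_root (M.-root (-1) : algC).
Proof.
move=> M1; have M0 := ltnW M1; set xi : algC := M.-root (-1).
have xiM : xi ^+ M = -1 by rewrite rootCK.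
have xi2M : xi ^+ (2 * M) = 1 by rewrite mulnC exprM xiM sqrrN expr1n.
have M20 : (0 < 2 * M)%N by lia.
have xi0 : xi != 0 by rewrite -normr_eq0 (unit_norm_expr M20 xi2M) oner_eq0.
have gen z : z ^+ (2 * M) = 1 -> exists m, z = xi ^+ m.
  move=> zM.
  have [/existsP[m /eqP ->]|/existsPn nz] :=
    boolP [exists m : 'I_(2 * M), z == xi ^+ m]; first by exists m.
  have {}nz m : z != xi ^+ m.
    by rewrite -(expr_mod _ xi2M); apply: (nz (Ordinal (ltn_pmod m M20))).
  have step y m : y ^+ (2 * M) = 1 -> (forall m, y != xi ^+ m) ->
      0 < 'Im y -> 0 < 'Im (y / xi ^+ m).
    move=> yM ny Iy; elim: m => [|m IH]; first by rewrite divr1.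
    have yxiM k : (y / xi ^+ k) ^+ (2 * M) = 1.
      by rewrite exprMn yM exprVn exprAC xi2M expr1n invr1 mul1r.
    have yxi1 := unit_norm_expr M20 (yxiM m.+1).
    have [//||I0] := real_ltgtP (rpred0 _) (Creal_Im (y / xi ^+ m.+1)).
      (* Here [xi] would be a product of two factors in the upper half-plane. *)
      move=> In; case: (@rootCN1_indecomposable M (y / xi ^+ m) (y / xi ^+ m.+1)^-1) => //.
        have y0 : y != 0 by rewrite -normr_eq0 (unit_norm_expr M20 yM) oner_eq0.
        rewrite exprS !invfM !invrK -/xi mulrACA divff // mul1r mulrCA mulVf ?mulr1 //.
        exact: expf_neq0.
      by rewrite unit_norm_inv // Im_conj oppr_gt0.
    have [e|e] := Im_eq0_unit_norm yxi1 (esym I0).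
      by have /eqP := ny m.+1; case; rewrite -[RHS]mul1r -e divfK ?expf_neq0.
    have /eqP := ny (M + m.+1)%N; case.
    by rewrite exprD xiM -e divfK ?expf_neq0.
  have z1 := unit_norm_expr M20 zM.
  have [Iz|Iz|I0] := real_ltgtP (rpred0 _) (Creal_Im z).
  - have := step z M zM nz Iz.
    by rewrite xiM invrN1 mulrN1 raddfN oppr_gt0 => /(lt_trans Iz); rewrite ltxx.
  - have := step (- z) M; rewrite xiM invrN1 mulrN1 raddfN opprK oppr_gt0 => /(_ _ _ Iz) h.
    have : 0 < 'Im z.
      apply: h => [|m]; first by rewrite exprM sqrrN -exprM.
      by apply: contra (nz (M + m)%N) => /eqP e; rewrite exprD xiM -e mulN1r opprK.
    by move=> /(lt_trans Iz); rewrite ltxx.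
  - by have [e|e] := Im_eq0_unit_norm z1 (esym I0); [exists 0%N|exists M; rewrite xiM].
have [z0 z0P] := C_prim_root_exists M20.
have [m z0E] := gen _ (prim_expr_order z0P).
have [d dP dM] := prim_order_exists M20 xi2M.
suff -> : (2 * M = d)%N by [].
apply/eqP; rewrite eqn_dvd dM (prim_order_dvd z0P) andbT.
by rewrite z0E exprAC (prim_expr_order dP) expr1n.
Qed.

(** This is sin(m pi/M) > 0. If [xi ^+ m.+2] were the first power below the real axis, [xi] would be
    the product of [- (xi ^+ m.+1)^-1] and [- xi ^+ m.+2], both above it. *)
Lemma Im_rootCN1_exp (M m : nat) : (0 < m < M)%N ->
  0 < 'Im ((M.-root (-1) : algC) ^+ m).
Proof.
case/andP=> m0 mM; have M1 : (1 < M)%N by lia.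
have := rootCN1_prim M1; set xi := M.-root (-1) => xiP.
have xi0 : xi != 0 by rewrite (prim_root_eq0 xiP); lia.
have xiM : xi ^+ M = -1 by rewrite rootCK // ltnW.
have xi2M k : (xi ^+ k) ^+ (2 * M) = 1 by rewrite exprAC (prim_expr_order xiP) expr1n.
have n1 k : `|xi ^+ k| = 1 by apply: unit_norm_expr (xi2M k); lia.
have I0 k : (0 < k < M)%N -> 'Im (xi ^+ k) != 0.
  move=> kM; apply/eqP => /(Im_eq0_unit_norm (n1 k)) h.
  have : (xi ^+ (k * 2) == 1) by rewrite exprM; case: h => ->; rewrite ?sqrrN expr1n.
  rewrite -(prim_order_dvd xiP) => /dvdn_leq; lia.
elim: m m0 mM => [//|[|m] IH] _ mM.
  by rewrite expr1 lt_neqAle eq_sym Im_rootC_ge0 // andbT -[xi]expr1 I0.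
have {}IH := IH isT (ltnW mM).
have [//||e] := real_ltgtP (rpred0 _) (Creal_Im (xi ^+ m.+2)).
  move=> In; case: (@rootCN1_indecomposable M (- (xi ^+ m.+1)^-1) (- xi ^+ m.+2)) => //.
  - by rewrite exprM sqrrN -exprM exprVn xi2M invr1.
  - by rewrite mulrNN [xi ^+ m.+2]exprS mulrCA mulVf ?expf_neq0 // mulr1.
  - by rewrite unit_norm_inv // raddfN /= Im_conj opprK.
  by rewrite raddfN oppr_gt0.
by have := I0 m.+2 mM; rewrite -e eqxx.
Qed.

(** * Signs of the real parts of the powers of exp(i pi/(2N)) *)

Section HalfPlanes.
Variable N : nat.
Hypothesis N_gt0 : (0 < N)%N.
Let xi : algC := (2 * N).-root (-1).

Let M_gt1 : (1 < 2 * N)%N. Proof. lia. Qed.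

Let xiP : (2 * (2 * N))%N.-primitive_root xi. Proof. exact: rootCN1_prim. Qed.

Let xi2N : xi ^+ (2 * N) = -1. Proof. by rewrite rootCK // ltnW. Qed.

Lemma rootCN1_quarter : xi ^+ N = 'i.
Proof.
have : xi ^+ N ^+ 2 == 'i ^+ 2 by rewrite -exprM mulnC xi2N sqrCi.
rewrite eqf_sqr => /orP[/eqP //|/eqP e].
have := @Im_rootCN1_exp (2 * N) N; rewrite -/xi e raddfN /= Im_i.
by rewrite oppr_gt0 ltr10 => /(_ ltac:(lia)).
Qed.

Lemma Im_rootCN1_exp_lt0 m : (2 * N < m < 4 * N)%N -> 'Im (xi ^+ m) < 0.
Proof.
move=> mN; have -> : m = (2 * N + (m - 2 * N))%N by lia.
by rewrite exprD xi2N mulN1r raddfN oppr_lt0 Im_rootCN1_exp //; lia.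
Qed.

Lemma Re_rootCN1_expE m : 'Re (xi ^+ m) = 'Im (xi ^+ (m + N)).
Proof. by rewrite exprD rootCN1_quarter mulrC ImMil. Qed.

(** A quarter turn reduces this to imaginary parts. For N = qn and m = 2(nk + qj), the zeros [N] and
    [3 * N] are the thresholds 1/2 and 3/2 of k/q + j/n. *)
Lemma Re_rootCN1_exp_sign m : (0 < m < 4 * N)%N ->
  ((0 < 'Re (xi ^+ m)) = (m < N)%N || (3 * N < m)%N)
  * (('Re (xi ^+ m) < 0) = (N < m < 3 * N)%N).
Proof.
move=> m4; rewrite Re_rootCN1_expE.
have per k : xi ^+ (4 * N + k) = xi ^+ k.
  by rewrite exprD (_ : (4 * N = 2 * (2 * N))%N) ?(prim_expr_order xiP) ?mul1r //; lia.
have [mN|mN|mN] := ltngtP m N.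
- have h : 0 < 'Im (xi ^+ (m + N)) by apply: Im_rootCN1_exp; lia.
  by rewrite h (lt_gtF h); split => //; lia.
- have [m3|m3|m3] := ltngtP m (3 * N).
  + have h : 'Im (xi ^+ (m + N)) < 0 by apply: Im_rootCN1_exp_lt0; lia.
    by rewrite h (lt_gtF h); split => //; lia.
  + have h : 0 < 'Im (xi ^+ (m + N)).
      rewrite (_ : m + N = 4 * N + (m - 3 * N))%N; last lia.
      by rewrite per; apply: Im_rootCN1_exp; lia.
    by rewrite h (lt_gtF h); split => //; lia.
  rewrite (_ : m + N = 4 * N + 0)%N; last lia.
  by rewrite per expr0 (Creal_ImP _ (rpred1 _)) ltxx; split; lia.
rewrite (_ : m + N = 2 * N)%N; last lia.
by rewrite xi2N raddfN /= (Creal_ImP _ (rpred1 _)) oppr0 ltxx; split; lia.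
Qed.
End HalfPlanes.

(** * Sylvester's law of inertia *)

Section Inertia.
Variable C : numClosedFieldType.

Lemma diag_form m (s u : 'rV[C]_m) :
  (u *m diag_mx s *m u^t*) 0 0 = \sum_i s 0 i * `|u 0 i| ^+ 2.
Proof.
rewrite mxE; apply: eq_bigr => i _.
by rewrite mul_mx_diag !mxE normCK mulrCA mulrA.
Qed.

(* Otherwise some [x <> 0] is supported where [d > 0], while [x *m R] vanishes
   where [s > 0], and the two sides disagree on the sign of the square of [x]. *)
Lemma card_pos_congr_le m (R : 'M[C]_m) (s d : 'rV[C]_m) :
  s \is a realmx -> R *m diag_mx s *m R^t* = diag_mx d ->
  (#|[set i | (0 < d 0 i)%R]| <= #|[set i | (0 < s 0 i)%R]|)%N.
Proof.
move=> /mxOverP sR RsR; rewrite leqNgt; apply/negP => lt_sd.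
set D := [set i | (0 < d 0 i)%R] in lt_sd; set S := [set i | (0 < s 0 i)%R] in lt_sd.
(* [E] embeds the coordinates in [D]; [v *m B = 0] says that [v *m E *m R] vanishes on [S], and [B]
   has more rows than columns. *)
pose E : 'M[C]_(#|D|, m) := \matrix_(a, i) (enum_val a == i)%:R.
pose B : 'M[C]_(#|D|, #|S|) := \matrix_(a, b) (E *m R) a (enum_val b).
have /rowV0Pn[v /sub_kermxP vB v0] : kermx B != 0.
  rewrite -mxrank_eq0 mxrank_ker -lt0n subn_gt0.
  exact: leq_ltn_trans (rank_leq_col B) lt_sd.
pose x := v *m E.
have xE a : x 0 (enum_val a) = v 0 a.
  rewrite mxE (bigD1 a) //= mxE eqxx mulr1 big1 ?addr0 // => b ba.
  by rewrite mxE (inj_eq enum_val_inj) (negbTE ba) mulr0.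
have xD i : i \notin D -> x 0 i = 0.
  move=> iD; rewrite mxE big1 // => a _; rewrite mxE.
  case: eqP => [ai|_]; last by rewrite mulr0.
  by rewrite -ai enum_valP in iD.
have xRS i : i \in S -> (x *m R) 0 i = 0.
  move=> iS; have /rowP/(_ (enum_rank_in iS i)) := vB.
  rewrite [RHS]mxE => <-; rewrite /x -mulmxA !mxE; apply: eq_bigr => a _.
  by rewrite [B _ _]mxE enum_rankK_in.
have : (x *m diag_mx d *m x^t*) 0 0 = ((x *m R) *m diag_mx s *m (x *m R)^t*) 0 0.
  by rewrite -RsR (trmx_mul x R) map_mxM !mulmxA.
rewrite !diag_form; apply/eqP; rewrite gt_eqF //; apply: (@le_lt_trans _ _ 0).
  apply: sumr_le0 => i _; case: (boolP (i \in S)) => iS.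
    by rewrite xRS // normr0 expr0n mulr0.
  rewrite mulr_le0_ge0 ?exprn_ge0 // real_leNgt ?rpred0 ?sR //.
  by rewrite inE in iS.
have [a va] : exists a, v 0 a != 0.
  apply/existsP; apply: contraR v0 => /existsPn v0.
  by apply/eqP/rowP => a; rewrite mxE; apply/eqP; rewrite -[_ == _]negbK.
have aD : 0 < d 0 (enum_val a) by have := enum_valP a; rewrite inE.
rewrite (bigD1 (enum_val a)) //= ltr_wpDr //.
  apply: sumr_ge0 => i _; case: (boolP (i \in D)) => iD.
    by rewrite inE in iD; rewrite mulr_ge0 ?exprn_ge0 // ltW.
  by rewrite xD // normr0 expr0n mulr0.
by rewrite xE mulr_gt0 // exprn_gt0 // normr_gt0.
Qed.

Lemma card_pos_congr m (R : 'M[C]_m) (s d : 'rV[C]_m) :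
  s \is a realmx -> d \is a realmx -> R \in unitmx ->
  R *m diag_mx s *m R^t* = diag_mx d ->
  #|[set i | (0 < d 0 i)%R]| = #|[set i | (0 < s 0 i)%R]|.
Proof.
move=> sR dR Ru e; apply/eqP; rewrite eqn_leq (card_pos_congr_le sR e) /=.
apply: (@card_pos_congr_le _ (invmx R)) => //.
rewrite -e !mulmxA mulVmx // mul1mx -mulmxA -map_mxM -trmx_mul mulVmx //.
by rewrite trmx1 map_mx1 mulmx1.
Qed.

Lemma card_neg_congr m (R : 'M[C]_m) (s d : 'rV[C]_m) :
  s \is a realmx -> d \is a realmx -> R \in unitmx ->
  R *m diag_mx s *m R^t* = diag_mx d ->
  #|[set i | (d 0 i < 0)%R]| = #|[set i | (s 0 i < 0)%R]|.
Proof.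
move=> sR dR Ru e.
have negE (t : 'rV[C]_m) : #|[set i | (t 0 i < 0)%R]| = #|[set i | (0 < (- t) 0 i)%R]|.
  by apply: eq_card => i; rewrite !inE mxE oppr_gt0.
rewrite !negE; apply: (@card_pos_congr _ R) => //.
- by apply/mxOverP => i j; rewrite mxE rpredN (mxOverP sR).
- by apply/mxOverP => i j; rewrite mxE rpredN (mxOverP dR).
by rewrite !raddfN /= mulNmx e.
Qed.
End Inertia.

Lemma char_poly_similar (F : fieldType) n (A U D : 'M[F]_n) :
  U \in unitmx -> A = invmx U *m D *m U -> char_poly A = char_poly D.
Proof.
move=> Uu AE; rewrite /char_poly.
suff -> : char_poly_mx A
    = map_mx polyC (invmx U) *m char_poly_mx D *m map_mx polyC U.
  rewrite !det_mulmx mulrAC -det_mulmx -map_mxM mulVmx //.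
  by rewrite map_mx1 det1 mul1r.
rewrite /char_poly_mx mulmxBr mulmxBl -!map_mxM -AE; congr (_ - _).
by rewrite scalar_mxC -mulmxA -map_mxM mulVmx // map_mx1 mulmx1.
Qed.

Lemma eigenvalues_diag n (A U : 'M[algC]_n) (s : 'rV_n) :
  U \in unitmx -> A = invmx U *m diag_mx s *m U ->
  perm_eq (eigenvalues A) [seq s 0 i | i <- enum 'I_n].
Proof.
move=> Uu AE; rewrite /eigenvalues; case: closed_field_poly_normal => r /= e.
apply: prod_XsubC_eq; move: e.
rewrite (monicP (char_poly_monic A)) scale1r => <-.
rewrite (char_poly_similar Uu AE) char_poly_trig ?diag_mx_is_trig //.
rewrite big_map big_enum /=.
by apply: eq_bigr => i _; rewrite mxE eqxx mulr1n.
Qed.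

(** By the spectral theorem [A] is unitarily similar to the diagonal of its eigenvalues, so
    [P *m U^t*] is an invertible congruence between two real diagonal matrices. *)
Lemma matrix_signature_congr m (A : 'M[int]_m) (P : 'M[algC]_m) (d : 'rV_m) :
  A^T = A -> d \is a realmx -> P \in unitmx ->
  P *m map_mx intr A *m P^t* = diag_mx d ->
  matrix_signature A = \sum_i ((0 < d 0 i)%R%:Z - (d 0 i < 0)%R%:Z).
Proof.
move=> As dR Pu e; set B := map_mx _ A in e.
have BR : B \is a realmx by apply/mxOverP => i j; rewrite mxE Rreal_int ?intr_int.
have Bh : B \is hermsymmx.
  apply/is_hermitianmxP; rewrite expr0 scale1r.
  apply/matrixP => i j; rewrite !mxE conj_Creal ?Rreal_int ?intr_int //.
  by rewrite -[in RHS]As mxE.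
have sR := hermitian_spectral_diag_real Bh.
have BE := orthomx_spectralP (hermitian_normalmx Bh).
set U := spectralmx B in BE; set s := spectral_diag B in BE sR.
have Uu : U \in unitmx := spectral_unit B.
have {}e : (P *m U^t*) *m diag_mx s *m (P *m U^t*)^t* = diag_mx d.
  rewrite -e [in RHS]BE /U invmx_unitary ?spectral_unitarymx // -/U.
  by rewrite trmx_mul map_mxM trmxCK !mulmxA.
have PUu : P *m U^t* \in unitmx.
  by rewrite unitmx_mul Pu -invmx_unitary ?spectral_unitarymx // unitmx_inv.
rewrite /matrix_signature -/B.
have pe := eigenvalues_diag Uu BE.
rewrite !(permP pe) !count_map.
have cnt (t : 'rV[algC]_m) (p : pred algC) :
    \sum_i (p (t 0%R i))%:Z = #|[set i | p (t 0%R i)]|%:Z.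
  rewrite -sum1dep_card (big_morph Posz PoszD erefl) [RHS]big_mkcond /=.
  by apply: eq_bigr => i _; case: (p _).
rewrite sumrB (cnt d (fun x => 0 < x)) (cnt d (fun x => x < 0)) /=.
rewrite (card_pos_congr sR dR PUu e) (card_neg_congr sR dR PUu e).
by rewrite !cardsE !cardE !size_filter -!enumT.
Qed.

(** * The Seifert form of a torus braid *)

Lemma nth_flatten_nseq (T : Type) (x0 : T) (s : seq T) n k : (k < n * size s)%N ->
  nth x0 (flatten (nseq n s)) k = nth x0 s (k %% size s).
Proof.
elim: n k => [//|n IH] k; rewrite mulSn => kn /=; rewrite nth_cat.
case: ltnP => ks; first by rewrite modn_small.
by rewrite IH -1?(modnDr (k - _)) ?subnK // ltn_subLR.
Qed.

(** Letters are numbered [t * r + i], with [t] the repetition and [i] the generator: their order is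
    lexicographic. *)
Lemma lex_eq r i j t s : (i < r)%N -> (j < r)%N ->
  (t * r + i == s * r + j)%N = (t == s) && (i == j).
Proof.
move=> ir jr; apply/eqP/andP => [e|[/eqP-> /eqP->] //].
have := congr1 (divn^~ r) e; have := congr1 (modn^~ r) e => /=.
by rewrite !modnMDl !modn_small // !divnMDl ?divn_small ?addn0; [|lia..] => -> ->.
Qed.

Lemma lex_lt r i j t s : (i < r)%N -> (j < r)%N ->
  (t * r + i < s * r + j)%N = (t < s)%N || (t == s) && (i < j)%N.
Proof.
move=> ir jr; case: (ltngtP t s) => [ts|st|->] /=; last by rewrite ltn_add2l.
  have := leq_mul2r r t.+1 s; rewrite ts orbT mulSn; lia.
have := leq_mul2r r s.+1 t; rewrite st orbT mulSn; lia.
Qed.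

Section TorusBraid.
Variables (q n : nat).
Notation r := q.-1.
Notation w := (torus_braid q n).

Lemma size_torus_braid : size w = (n * r)%N.
Proof. by rewrite size_flatten /shape map_nseq sumn_nseq size_map size_enum_ord mulnC. Qed.

Lemma ltn_torus_braid (k : 'I_(size w)) : (k < n * r)%N.
Proof. by rewrite -size_torus_braid. Qed.

Lemma strands_gt1 (k : 'I_(size w)) : (0 < r)%N.
Proof.
by have := leq_ltn_trans (leq0n k) (ltn_torus_braid k); rewrite muln_gt0 => /andP[].
Qed.

Lemma torus_braid_letter (k : 'I_(size w)) :
  (tnth (in_tuple w) k).1 = (k %% r)%N :> nat /\ (tnth (in_tuple w) k).2 = true.
Proof.
have kn := ltn_torus_braid k; have r0 := strands_gt1 k.
set x0 := tnth (in_tuple w) k.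
have -> : x0 = nth x0 w k := tnth_nth x0 (in_tuple w) k.
have sz : size [seq (i, true) | i <- enum 'I_r] = r by rewrite size_map size_enum_ord.
rewrite /torus_braid nth_flatten_nseq sz //.
rewrite (nth_map x0.1) ?size_enum_ord ?ltn_pmod //=.
by rewrite nth_enum_ord // ltn_pmod.
Qed.

Lemma generator_torus_braid (k : 'I_(size w)) : generator k = (k %% r)%N.
Proof. by case: (torus_braid_letter k). Qed.

Lemma crossing_sign_torus_braid (k : 'I_(size w)) : crossing_sign k = 1.
Proof. by rewrite /crossing_sign; case: (torus_braid_letter k) => _ ->. Qed.

(** The word has period [r] and uses each generator once per period. *)
Lemma mem_loops_torus_braid (c : 'I_(size w) * 'I_(size w)) :
  (c \in loops w) = (c.2 == c.1 + r :> nat)%N.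
Proof.
have c1 := ltn_torus_braid c.1; have c2 := ltn_torus_braid c.2.
have r0 := strands_gt1 c.1.
rewrite inE !generator_torus_braid; apply/and3P/eqP => [[lt /eqP e /forallP nb]|e].
  have le : (c.1 + r <= c.2)%N.
    rewrite leqNgt; apply/negP => gt.
    have := @modn_small (c.2 - c.1) r; rewrite ltn_subLR ?(ltnW lt) // gt => /(_ isT).
    have : (r %| c.2 - c.1)%N by rewrite -eqn_mod_dvd ?(ltnW lt) // e.
    by move=> /eqP ->; lia.
  have mw : (c.1 + r < size w)%N := leq_ltn_trans le (ltn_ord c.2).
  have := nb (Ordinal mw); rewrite generator_torus_braid /= modnDr eqxx implybF.
  lia.
split; [lia | by rewrite e modnDr | apply/forallP => m; apply/implyP].
rewrite generator_torus_braid => /andP[lt1 lt2].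
have ne : (0 < m - c.1 < r)%N by lia.
apply/negP; rewrite eqn_mod_dvd ?(ltnW lt1) // => /dvdn_leq; lia.
Qed.

(** Grid coordinates of a loop: its generator, and the repetition holding its first band. *)
Definition column (a : 'I_#|loops w|) : nat := ((enum_val a).1 %% r)%N.
Definition level (a : 'I_#|loops w|) : nat := ((enum_val a).1 %/ r)%N.

Lemma sum_mul_nat (V : nmodType) (F : nat -> V) m :
  \sum_(0 <= k < m * r) F k = \sum_(t < m) \sum_(i < r) F (t * r + i)%N.
Proof.
elim: m => [|m IH]; first by rewrite big_ord0 big_geq.
rewrite big_ord_recr /= -IH mulSn addnC (@big_cat_nat _ _ _ (m * r)) ?leq_addr //=.
congr (_ + _); have := big_addn 0 (m * r + r) (m * r) xpredT F.
rewrite add0n addKn => ->; rewrite big_mkord.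
by apply: eq_bigr => i _; rewrite addnC.
Qed.

(** A loop is determined by its first band, which is any letter outside the last repetition. *)
Lemma sum_loops (V : nmodType) (F : nat -> nat -> V) :
  \sum_a F (column a) (level a) = \sum_(i < r) \sum_(t < n.-1) F i t.
Proof.
rewrite -(big_enum_val (fun c : 'I_(size w) * 'I_(size w) =>
  F (c.1 %% r)%N (c.1 %/ r)%N)) /=.
rewrite (eq_bigl (fun c : 'I_(size w) * 'I_(size w) => true && (c.2 == c.1 + r :> nat)%N));
  last by move=> c; rewrite mem_loops_torus_braid.
rewrite -(pair_big_dep xpredT (fun c1 c2 : 'I_(size w) => (c2 == c1 + r :> nat)%N)
  (fun c1 _ => F (c1 %% r)%N (c1 %/ r)%N)) /=.
transitivity (\sum_(c1 < size w | (c1 < n.-1 * r)%N) F (c1 %% r)%N (c1 %/ r)%N).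
  rewrite [RHS]big_mkcond; apply: eq_bigr => c1 _.
  have e : (c1 + r < size w)%N = (c1 < n.-1 * r)%N.
    have -> : (c1 + r < size w)%N = (c1 + r < n * r)%N.
      by congr (leq _ _); rewrite size_torus_braid.
    have n0 : (0 < n)%N.
      have := leq_ltn_trans (leq0n c1) (ltn_torus_braid c1).
      by rewrite muln_gt0 => /andP[].
    have aux m k : (0 < m)%N -> (k + r < m * r)%N = (k < m.-1 * r)%N.
      by case: m => // m _; rewrite mulSn [(r + _)%N]addnC ltn_add2r.
    exact: aux.
  case: ifP => c1n; last first.
    rewrite big_pred0 // => c2; apply/eqP => c2E.
    by have := ltn_ord c2; rewrite c2E e c1n.
  by rewrite -e in c1n; rewrite (big_pred1 (Ordinal c1n)) // => c2.
rewrite -(big_mkord (fun k => k < n.-1 * r)%N (fun k => F (k %% r)%N (k %/ r)%N)).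
rewrite size_torus_braid.
have le : (n.-1 * r <= n * r)%N by rewrite leq_mul2r leq_pred orbT.
rewrite -(big_nat_widen 0 _ _ xpredT _ le).
rewrite (sum_mul_nat (fun k => F (k %% r)%N (k %/ r)%N)) exchange_big /=.
apply: eq_bigr => i _; apply: eq_bigr => t _.
by rewrite modnMDl modn_small // divnMDl ?divn_small ?addn0 //; case: (r) i => // -[].
Qed.

Lemma columnP a : (column a < r)%N.
Proof. by rewrite ltn_mod (strands_gt1 (enum_val a).1). Qed.

Lemma enum_val_loops (a : 'I_#|loops w|) :
  ((enum_val a).1 = level a * r + column a :> nat)%N /\
  ((enum_val a).2 = (level a).+1 * r + column a :> nat)%N.
Proof.
have := enum_valP a; rewrite mem_loops_torus_braid => /eqP ->.
by rewrite mulSn -addnA -divn_eq addnC.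
Qed.

Lemma levelP a : (level a < n.-1)%N.
Proof.
have [_ e] := enum_val_loops a; have ca := columnP a.
have := ltn_torus_braid (enum_val a).2.
by rewrite e -[X in (_ < X)%N]addn0 lex_lt //; lia.
Qed.

(** The Seifert form of loops at [(i, t)] and [(j, s)] in the grid, all crossings being positive. *)
Definition torus_pairing (i t j s : nat) : int :=
  if j == i then (s.+1 == t)%:Z - (s == t)%:Z
  else if j.+1 == i then (s == t.+1)%:Z - (s == t)%:Z else 0.

Lemma seifert_pairing_torus_braid (a b : 'I_#|loops w|) :
  seifert_pairing (enum_val a) (enum_val b)
  = torus_pairing (column a) (level a) (column b) (level b).
Proof.
have [a1 a2] := enum_val_loops a; have [b1 b2] := enum_val_loops b.
have ca := columnP a; have cb := columnP b.
rewrite /seifert_pairing !crossing_sign_torus_braid !generator_torus_braid -!/(column _).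
have -> : (enum_val a == enum_val b) = (level a == level b) && (column a == column b).
  rewrite -(lex_eq _ _ ca cb) -a1 -b1; apply/eqP/eqP => [->//|/val_inj e].
  have e2 : (enum_val a).2 = (enum_val b).2.
    by apply: val_inj; rewrite /= a2 b2 !mulSn -!addnA -a1 -b1 e.
  by move: e e2; case: (enum_val a) (enum_val b) => ? ? [? ?] /= -> ->.
rewrite -!val_eqE /= a1 a2 b1 b2 !lex_eq // !lex_lt // /torus_pairing.
move: (level a) (level b) (column a) (column b) ca cb => t s i j ca cb.
by do !case: ifP; lia.
Qed.
End TorusBraid.

(** * Diagonalization *)

Lemma sum_unity (C : fieldType) n (u : C) : u ^+ n = 1 ->
  \sum_(s < n) u ^+ s = n%:R * (u == 1)%:R.
Proof.
move=> un; case: eqP => [->|/eqP u1]; last first.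
  rewrite mulr0; apply: (mulfI (x := u - 1)); first by rewrite subr_eq0.
  by rewrite -subrX1 un subrr mulr0.
rewrite mulr1 (eq_bigr (fun=> 1)); last by move=> i _; rewrite expr1n.
by rewrite sumr_const card_ord.
Qed.

(** As [g] vanishes just outside the range, edges of the grid need no special case. *)
Lemma sum_shift_delta (C : pzRingType) m (g : nat -> C) t : (t <= m.+1)%N ->
  g 0%N = 0 -> g m.+1 = 0 -> \sum_(s < m) (s.+1 == t)%:R * g s.+1 = g t.
Proof.
move=> tm g0 gm; have [->|t0] := posnP t; first by rewrite g0 big1 // => s _; rewrite mul0r.
have [->|tm1] := eqVneq t m.+1.
  rewrite gm big1 // => s _; rewrite eqSS; have := ltn_ord s.
  by rewrite ltn_neqAle => /andP[/negbTE -> _]; rewrite mul0r.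
have tm' : (t.-1 < m)%N by lia.
rewrite (bigD1 (Ordinal tm')) //= prednK // eqxx mul1r big1 ?addr0 // => s st.
suff -> : (s.+1 == t) = false by rewrite mul0r.
by apply: contra_neqF st => /eqP e; apply: val_inj; rewrite /= -e.
Qed.

Section Gram.
Variable C : numClosedFieldType.
Implicit Types y z : C.

(* The factor [z ^+ i.+1] is a twist: in the basis of loops the Seifert form is
   only a tensor product of those of T(2,q) and T(2,n) after applying the i-th
   power of the monodromy of T(2,n) to column [i]. *)
Definition torus_vector y z (i t : nat) : C :=
  (y ^+ i.+1 - 1) * z ^+ i.+1 * (z ^+ t.+1 - 1).

(** The vector is a product [G j.+1 * H s.+1] with factors vanishing at both ends. The twist makes
    the terms without [y] cancel, leaving a pure exponential. *)
Lemma torus_pairing_vector (q n : nat) y z i t : (i < q.-1)%N -> (t < n.-1)%N ->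
  y ^+ q = 1 -> z ^+ n = 1 ->
  \sum_(j < q.-1) \sum_(s < n.-1)
     (torus_pairing i t j s)%:~R * torus_vector y z j s
  = - (y - 1) * (z - 1) * (y ^+ i * z ^+ (i + t).+1).
Proof.
move=> iq tn yq zn.
have q0 : q = q.-1.+1 by lia.
have n0 : n = n.-1.+1 by lia.
pose G j := (y ^+ j - 1) * z ^+ j.
pose H s : C := z ^+ s - 1.
have G0 : G 0%N = 0 by rewrite /G expr0 subrr mul0r.
have Gq : G q.-1.+1 = 0 by rewrite /G -q0 yq subrr mul0r.
have H0 : H 0%N = 0 by rewrite /H expr0 subrr.
have Hn : H n.-1.+1 = 0 by rewrite /H -n0 zn subrr.
have hs u : (u <= n.-1.+1)%N -> \sum_(s < n.-1) (s.+1 == u)%:R * H s.+1 = H u.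
  by move=> un; apply: sum_shift_delta.
transitivity (\sum_(j < q.-1) ((j.+1 == i.+1)%:R * G j.+1 * (H t - H t.+1)
     + (j.+1 == i)%:R * G j.+1 * (H t.+2 - H t.+1))).
  apply: eq_bigr => j _.
  have [/hs <- /hs <- /hs <-] : [/\ t <= n.-1.+1, t.+1 <= n.-1.+1 & t.+2 <= n.-1.+1]%N.
    by split; lia.
  rewrite -!sumrB !mulr_sumr -big_split; apply: eq_bigr => s _ /=.
  rewrite /torus_pairing /torus_vector -/(G j.+1) -/(H s.+1) !eqSS.
  have [->|ji] := eqVneq (j : nat) i.
    rewrite (_ : (i.+1 == i) = false); last by lia.
    by rewrite rmorphB /=; ring.
  by case: eqP => _; rewrite ?rmorphB /=; ring.
rewrite big_split -!mulr_suml !sum_shift_delta //; [|lia..].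
rewrite /G /H !exprS exprD /=; ring.
Qed.

(** The sum over [t] forces [z = z']; the twists then cancel and the sum over [i] forces
    [y = y']. *)
Lemma torus_vector_dot (q n : nat) y z y' z' : (0 < q)%N -> (0 < n)%N ->
  y ^+ q = 1 -> z ^+ n = 1 -> y' ^+ q = 1 -> z' ^+ n = 1 -> y != 1 -> z != 1 ->
  \sum_(i < q.-1) \sum_(t < n.-1)
     (torus_vector y' z' i t)^* * (y ^+ i * z ^+ (i + t).+1)
  = (q * n)%:R * (y * z)^-1 * ((y == y') && (z == z'))%:R.
Proof.
move=> q0 n0 yq zn yq' zn' y1 z1.
have n1 m u : (0 < m)%N -> u ^+ m = 1 -> u^* = u^-1 :> C.
  by move=> m0 um; rewrite unit_norm_inv // (unit_norm_expr m0 um).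
have [y0 z0 y0' z0'] : [/\ y != 0, z != 0, y' != 0 & z' != 0].
  have nz m u : (0 < m)%N -> u ^+ m = 1 -> u != 0 :> C.
    by move=> m0 um; rewrite -normr_eq0 (unit_norm_expr m0 um) oner_eq0.
  by split; [apply: nz yq|apply: nz zn|apply: nz yq'|apply: nz zn'].
have twist m (u u' : C) : (0 < m)%N -> u ^+ m = 1 -> u' ^+ m = 1 -> u != 1 -> u' != 0 ->
    \sum_(i < m.-1) (u'^-1 ^+ i.+1 - 1) * u ^+ i.+1 = m%:R * (u == u')%:R.
  move=> m0 um um' u1 u0.
  (* The term of index 0 vanishes, which completes the period. *)
  transitivity (\sum_(i < m) (u'^-1 ^+ i - 1) * u ^+ i).
    by case: (m) m0 => // k _; rewrite big_ord_recl expr0 subrr mul0r add0r.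
  rewrite (eq_bigr (fun i : 'I_m => (u / u') ^+ i - u ^+ i)); last first.
    by move=> i _; rewrite mulrBl mul1r -exprMn mulrC.
  rewrite sumrB !sum_unity ?exprMn ?exprVn ?um ?um' ?invr1 ?mulr1 //.
  by rewrite (negbTE u1) mulr0 subr0 -(inj_eq (mulIf u0)) divfK // mul1r.
have row i : \sum_(t < n.-1) (torus_vector y' z' i t)^* * (y ^+ i * z ^+ (i + t).+1)
   = (y'^-1 ^+ i.+1 - 1) * y ^+ i.+1 * (z / z') ^+ i.+1 * (y * z)^-1
     * (n%:R * (z == z')%:R).
  rewrite -(twist _ _ _ n0 zn zn') // mulr_sumr; apply: eq_bigr => t _.
  rewrite /torus_vector !rmorphM !rmorphB !rmorphXn !rmorph1 /=.
  rewrite (n1 _ _ q0 yq') (n1 _ _ n0 zn') !exprMn.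
  rewrite -addSn exprD !exprS.
  by field; rewrite z0' z0 y0 y0'.
under eq_bigr do rewrite row.
rewrite -!mulr_suml.
have [->|_] := eqVneq z z'; last by rewrite !andbF !mulr0.
rewrite divff // andbT (eq_bigr (fun i : 'I_q.-1 => (y'^-1 ^+ i.+1 - 1) * y ^+ i.+1)).
  by rewrite (twist _ _ _ q0 yq yq') // natrM mulr1; ring.
by move=> i _; rewrite expr1n mulr1.
Qed.
End Gram.

(** * The signature as a lattice count *)

Section TorusSignature.
Variables q n : nat.
Hypotheses (q_gt0 : (0 < q)%N) (n_gt0 : (0 < n)%N).
Let xi : algC := (2 * (q * n)).-root (-1).
Notation w := (torus_braid q n).

Let N_gt0 : (0 < q * n)%N. Proof. by rewrite muln_gt0 q_gt0. Qed.

Let xiP : (2 * (2 * (q * n)))%N.-primitive_root xi.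
Proof. by apply: rootCN1_prim; lia. Qed.

(** As [xi] is exp(i pi/(2qn)), these are exp(2 i pi k/q) and exp(2 i pi j/n), with square roots
    among the powers of [xi]. *)
Let y k : algC := xi ^+ (4 * n * k).
Let z j : algC := xi ^+ (4 * q * j).

Let yX k : y k ^+ q = 1.
Proof.
apply/eqP; rewrite -exprM -(prim_order_dvd xiP); apply/dvdnP; exists k; lia.
Qed.

Let zX k : z k ^+ n = 1.
Proof.
apply/eqP; rewrite -exprM -(prim_order_dvd xiP); apply/dvdnP; exists k; lia.
Qed.

Let y_inj k k' : (k < q)%N -> (k' < q)%N -> (y k == y k') = (k == k').
Proof.
move=> kq kq'; rewrite (eq_prim_root_expr xiP).
have e : (2 * (2 * (q * n)) = 4 * n * q)%N by lia.
by rewrite e -!muln_modr eqn_pmul2l ?muln_gt0 // !modn_small.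
Qed.

Let z_inj k k' : (k < n)%N -> (k' < n)%N -> (z k == z k') = (k == k').
Proof.
move=> kn kn'; rewrite (eq_prim_root_expr xiP).
have e : (2 * (2 * (q * n)) = 4 * q * n)%N by lia.
by rewrite e -!muln_modr eqn_pmul2l ?muln_gt0 // !modn_small.
Qed.

(** The grid also indexes the pairs of roots; the shift by one skips the root 1, where the vector is
    zero. *)
Let P : 'M[algC]_#|loops w| :=
  \matrix_(a, b)
    (torus_vector (y (column a).+1) (z (level a).+1) (column b) (level b))^*.

Let V : 'M[algC]_#|loops w| := map_mx intr (seifert_matrix w).

Let gram_diag k j : algC :=
  - (y k - 1) * (z j - 1) * (y k * z j)^-1 * (q * n)%:R.

Lemma column_lt (a : 'I_#|loops w|) : ((column a).+1 < q)%N.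
Proof. by have := columnP a; lia. Qed.

Lemma level_lt (a : 'I_#|loops w|) : ((level a).+1 < n)%N.
Proof. by have := levelP a; lia. Qed.

Let y0 : y 0 = 1. Proof. by rewrite /y muln0 expr0. Qed.
Let z0 : z 0 = 1. Proof. by rewrite /z muln0 expr0. Qed.

Lemma torus_gram :
  P *m V *m P^t* = diag_mx (\row_a gram_diag (column a).+1 (level a).+1).
Proof.
apply/matrixP => a b; rewrite -mulmxA !mxE.
have ca := column_lt a; have cb := column_lt b.
have la := level_lt a; have lb := level_lt b.
transitivity (- (y (column b).+1 - 1) * (z (level b).+1 - 1) *
   \sum_(c : 'I_#|loops w|)
     (torus_vector (y (column a).+1) (z (level a).+1) (column c) (level c))^*
     * (y (column b).+1 ^+ column c * z (level b).+1 ^+ (column c + level c).+1)).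
  rewrite mulr_sumr; apply: eq_bigr => c _; rewrite !mxE mulrCA; congr (_ * _).
  rewrite -(torus_pairing_vector (columnP c) (levelP c) (yX _) (zX _)).
  rewrite -(sum_loops q n (fun j s =>
    (torus_pairing (column c) (level c) j s)%:~R * torus_vector _ _ j s)).
  by apply: eq_bigr => d _; rewrite !mxE seifert_pairing_torus_braid conjCK.
rewrite (sum_loops q n (fun i t =>
  (torus_vector _ _ i t)^* * (_ ^+ i * _ ^+ (i + t).+1))).
rewrite torus_vector_dot //; last 2 first.
- by rewrite -y0 y_inj.
- by rewrite -z0 z_inj.
rewrite y_inj // z_inj // !eqSS.
have -> : (column b == column a) && (level b == level a) = (a == b).
  apply/andP/eqP => [[/eqP e1 /eqP e2]|-> //]; apply: enum_val_inj.
  have [a1 a2] := enum_val_loops a; have [b1 b2] := enum_val_loops b.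
  rewrite -e1 -e2 -{}b1 -{}b2 in a1 a2.
  move: (val_inj a1) (val_inj a2).
  by case: (enum_val a) (enum_val b) => ? ? [? ?] /= -> ->.
case: eqP => [->|_]; last by rewrite !mulr0.
by rewrite /gram_diag mulr1 mulrb; ring.
Qed.

(** With [al] the square root of [y k] in the upper half-plane, 1 - 1/y = 2 i Im(al)/al, and
    likewise for z; the two factors i absorb the minus sign. *)
Lemma gram_diagE k j : (0 < k < q)%N -> (0 < j < n)%N ->
  exists2 c : algC, 0 < c & gram_diag k j = c * (xi ^+ (2 * (n * k + q * j)))^*.
Proof.
move=> kq jn.
pose al := xi ^+ (2 * n * k); pose be := xi ^+ (2 * q * j).
have Ial : 0 < 'Im al by apply: Im_rootCN1_exp; nia.
have Ibe : 0 < 'Im be by apply: Im_rootCN1_exp; nia.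
have nrm m : `|xi ^+ m| = 1.
  apply: (@unit_norm_expr _ _ (2 * (2 * (q * n)))); first lia.
  by rewrite exprAC (prim_expr_order xiP) expr1n.
have nz m : xi ^+ m != 0 by rewrite -normr_eq0 nrm oner_eq0.
have ImE' (u : algC) : `|u| = 1 -> u - u^-1 = 2 * 'i * 'Im u.
  move=> u1; rewrite unit_norm_inv // ImE.
  transitivity ('i ^+ 2 * (u^* - u)); last by field.
  by rewrite sqrCi mulN1r opprB.
exists (4 * (q * n)%:R * 'Im al * 'Im be).
  by rewrite !mulr_gt0 ?ltr0n.
rewrite -unit_norm_inv //.
have -> : xi ^+ (2 * (n * k + q * j)) = al * be by rewrite -exprD; congr (_ ^+ _); lia.
have yE : y k = al * al by rewrite -exprD; congr (_ ^+ _); lia.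
have zE : z j = be * be by rewrite -exprD; congr (_ ^+ _); lia.
have al0 : al != 0 := nz _; have be0 : be != 0 := nz _.
transitivity (- ((al - al^-1) * (be - be^-1)) * (al * be)^-1 * (q * n)%:R).
  by rewrite /gram_diag yE zE; field; rewrite al0 be0.
rewrite !ImE' ?nrm //.
transitivity (- ('i ^+ 2) * (4 * 'Im al * 'Im be) * (al * be)^-1 * (q * n)%:R).
  by rewrite expr2; ring.
by rewrite sqrCi; ring.
Qed.

(** As [V] is real, symmetrizing doubles the real parts of the diagonal entries. Their signs are
    opposite to [lattice_sign], as is the sign in [link_signature]. *)
Lemma torus_link_signatureE : torus_link_signature q n = lattice_sum q n.
Proof.
pose d := \row_a (gram_diag (column a).+1 (level a).+1
                  + (gram_diag (column a).+1 (level a).+1)^*)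
  : 'rV[algC]_#|loops w|.
have Vc : V^t* = V^T.
  by apply/matrixP => a b; rewrite !mxE conj_Creal // Rreal_int ?intr_int.
have dE : P *m map_mx intr (seifert_matrix w + (seifert_matrix w)^T) *m P^t* = diag_mx d.
  rewrite map_mxD -map_trmx -/V mulmxDr mulmxDl torus_gram.
  have -> : P *m V^T *m P^t* = (P *m V *m P^t*)^t*.
    by rewrite !trmx_mul !map_mxM trmxCK Vc mulmxA.
  rewrite torus_gram tr_diag_mx map_diag_mx -raddfD /=; congr diag_mx.
  by apply/rowP => a; rewrite !mxE.
(* Invertibility is read off the Gram matrix, whose diagonal entries are nonzero. *)
have Pu : P \in unitmx.
  have : P *m V *m P^t* \in unitmx.
    rewrite torus_gram unitmxE det_diag unitfE; apply/prodf_neq0 => a _; rewrite mxE.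
    have [|| c c0 ->] := @gram_diagE (column a).+1 (level a).+1.
    - exact: column_lt.
    - exact: level_lt.
    apply: mulf_neq0; first by rewrite gt_eqF.
    rewrite conjC_eq0 expf_neq0 //.
    by rewrite (prim_root_eq0 xiP); lia.
  by rewrite !unitmx_mul => /andP[/andP[]].
have dR : d \is a realmx.
  by apply/mxOverP => i a; rewrite !mxE CrealE rmorphD /= conjCK addrC.
rewrite /torus_link_signature /link_signature.
rewrite (matrix_signature_congr _ dR Pu dE); last by rewrite raddfD /= trmxK addrC.
rewrite -sumrN /lattice_sum.
transitivity (\sum_(a : 'I_#|loops w|) lattice_sign q n (column a).+1 (level a).+1).
  apply: eq_bigr => a _; rewrite /d mxE.
  have ca := column_lt a; have la := level_lt a.
  have [|| c c0 ->] := @gram_diagE (column a).+1 (level a).+1 => //.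
  rewrite rmorphM /= conjCK (conj_Creal (gtr0_real c0)) -mulrDr.
  set u := xi ^+ _.
  have -> : c * (u^* + u) = c * 2 * 'Re u by rewrite ReE; field.
  have c2 : 0 < c * 2 by rewrite mulr_gt0.
  rewrite pmulr_rgt0 // pmulr_rlt0 // /u.
  have [|-> ->] := @Re_rootCN1_exp_sign (q * n) N_gt0
    (2 * (n * (column a).+1 + q * (level a).+1)).
    by apply/andP; split; nia.
  by rewrite /lattice_sign opprB.
rewrite (sum_loops q n (fun i t => lattice_sign q n i.+1 t.+1)).
rewrite big_add1 big_mkord; apply: eq_bigr => i _.
by rewrite big_add1 big_mkord.
Qed.
End TorusSignature.

Theorem lemma3p5 (q n : nat) (hq : (1 <= q)%N) (hqn : (q <= n)%N) :
  (q%:R - 1) * n%:R / 2 <= (torus_link_signature q n)%:~R :> rat /\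
  (torus_link_signature q n)%:~R
    <= q%:R * (n%:R + 1) / 2 - coeff_a q - coeff_b q n :> rat.
Proof.
rewrite torus_link_signatureE ?(leq_trans hq) //.
have := @lattice_sum_bounds q n; rewrite hq hqn => /(_ isT) /andP[].
rewrite -2!(ler_int rat) !(rmorphB, rmorphD, rmorphM, rmorph1) /= !pmulrn.
move: (_%:~R : rat) => s lo hi; rewrite /coeff_a /coeff_b.
(* The integer corrections are twice [coeff_a] and [coeff_b]. *)
move: hi; case: (odd q); case: (odd n) => /= hi; split; lra.
Qed.
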